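(* Let $f, h_1,\dots,h_p, g_1,\dots,g_m:\mathbb{R}^n\to\mathbb{R}$ be twice continuously differentiable and consider the problem (NLP) of minimizing $f(x)$ over $x\in\mathbb{R}^n$ subject to $h_j(x)=0$ ($j=1,\dots,p$) and $g_i(x)\le 0$ ($i=1,\dots,m$). Let $\{x^k\}$ be a sequence generated by the augmented Lagrangian method (with quartic penalization of the inequality constraints) for (NLP), and let $x^*$ be any accumulation point of $\{x^k\}$. Suppose that $$\lim_{k\to\infty}\sum_{j=1}^p h_j(x^k)^2=0\quad\text{and}\quad\lim_{k\to\infty}\sum_{i=1}^m\max\{0,g_i(x^k)\}=0.$$ Then $x^*$ is an $\tilde S$-SAKKT2 point, i.e. $x^*$ satisfies the $\tilde S$-SAKKT2 conditions for (NLP).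
   Context: Write $h=(h_1,\dots,h_p)$, $g=(g_1,\dots,g_m)$; $\|\cdot\|$ is the Euclidean norm and $\|\cdot\|_\infty$ the max norm; $\max$ and $\min$ of vectors are taken componentwise; $\mathbb{I}$ is the identity matrix and $\succeq$ the positive semidefinite order on symmetric matrices. For $x\in\mathbb{R}^n$, $A(x)=\{i\in\{1,\dots,m\}: g_i(x)=0\}$. The Lagrangian is $L(x,\mu,\omega)=f(x)+h(x)^\top\mu+g(x)^\top\omega$ for $x\in\mathbb{R}^n$, $\mu\in\mathbb{R}^p$, $\omega\in\mathbb{R}^m_+$. The notation $\varepsilon_k\searrow 0$ means that the positive scalars $\varepsilon_k$ converge monotonically to $0$. A sequence $\{(x^k,\mu^k,\omega^k,\varepsilon_k)\}\subseteq\mathbb{R}^n\times\mathbb{R}^p\times\mathbb{R}^m_+\times(0,\infty)$ with $x^k\to\bar x$ and $\varepsilon_k\searrow 0$ satisfies AKKT (approximate KKT) if for all $k$: (i) $\big\|\nabla f(x^k)+\sum_{j=1}^p\mu_j^k\nabla h_j(x^k)+\sum_{i=1}^m\omega_i^k\nabla g_i(x^k)\big\|\le\varepsilon_k$; (ii) $\|h(x^k)\|\le\varepsilon_k$; (iii) $\|\max\{0,g(x^k)\}\|\le\varepsilon_k$; (iv) $\|\min\{\omega^k,-g(x^k)\}\|\le\varepsilon_k$. $\tilde S$-SAKKT2: $\bar x$ satisfies $\tilde S$-SAKKT2 if there exists a sequence $\{(x^k,\mu^k,\omega^k,\varepsilon_k)\}\subseteq\mathbb{R}^n\times\mathbb{R}^p\times\mathbb{R}^m_+\times(0,\infty)$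 (not necessarily the sequences of the algorithm below) with $x^k\to\bar x$, $\varepsilon_k\searrow0$, satisfying AKKT and $d^\top\nabla^2_{xx}L(x^k,\mu^k,\omega^k)d\ge-\varepsilon_k\|d\|^2$ for all $d\in\tilde S(x^k,\bar x,\omega^k)$, where $\tilde S(y,x,\omega)$ is the set of $d\in\mathbb{R}^n$ such that $\nabla h_j(y)^\top d=0$ for $j=1,\dots,p$ and $\nabla g_i(y)^\top d=0$ for $i\in A(x)$ with $\omega_i>0$. Augmented Lagrangian: for $x\in\mathbb{R}^n$, $\rho>0$, $\mu\in\mathbb{R}^p$, $\omega\in\mathbb{R}^m_+$, $$L_\rho(x,\mu,\omega)=f(x)+\frac{\rho}{2}\sum_{j=1}^p\Big[h_j(x)+\frac{\mu_j}{\rho}\Big]^2+\frac{\rho}{4}\sum_{i=1}^m\max\Big\{0,g_i(x)+\frac{\omega_i}{\rho}\Big\}^4 .$$ Augmented Lagrangian method: Step 1. Let $\mu_{\min}<\mu_{\max}$, $\omega_{\max}>0$, $\gamma>1$, $\rho_1>0$, $\tau\in(0,1)$, and $\{\varepsilon_k\}\subset(0,\infty)$ with $\varepsilon_k\searrow0$. Let $\mu_j^1\in[\mu_{\min},\mu_{\max}]$ for all $j\in\{1,\dots,p\}$ and $\omega_i^1\in[0,\omega_{\max}]$ for all $i\in\{1,\dots,m\}$. Let $x^0\in\mathbb{R}^n$ and $V^0:=\max\{0,g(x^0)\}$. Set $k:=1$. Step 2. Obtain an approximate minimizer $x^k$ of $L_{\rho_k}(\cdot,\mu^k,\omega^k)$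 satisfying $\|\nabla_xL_{\rho_k}(x^k,\mu^k,\omega^k)\|\le\varepsilon_k$ and $\nabla^2_{xx}L_{\rho_k}(x^k,\mu^k,\omega^k)\succeq-\varepsilon_k\mathbb{I}$. Step 3. Define $V_i^k:=\max\{g_i(x^k),-\omega_i^k/\rho_k\}$ for $i\in\{1,\dots,m\}$. If $\max\{\|h(x^k)\|_\infty,\|V^k\|_\infty\}\le\tau\max\{\|h(x^{k-1})\|_\infty,\|V^{k-1}\|_\infty\}$, set $\rho_{k+1}:=\rho_k$; otherwise set $\rho_{k+1}:=\gamma\rho_k$. Step 4. Compute $\mu_j^{k+1}:=\max(\mu_{\min},\min(\mu_{\max},\mu_j^k+\rho_kh_j(x^k)))\in[\mu_{\min},\mu_{\max}]$ for all $j$ and $\omega_i^{k+1}:=\max(0,\min(\omega_{\max},\omega_i^k+\rho_kg_i(x^k)))\in[0,\omega_{\max}]$ for all $i$. Set $k:=k+1$ and go to Step 2. *)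

(* Defs.v *)
From HB Require Import structures.
From mathcomp Require Import all_boot all_order all_algebra.
From mathcomp Require Import all_classical all_reals all_analysis.

Set Implicit Arguments.
Unset Strict Implicit.
Unset Printing Implicit Defensive.

Import Order.TTheory GRing.Theory Num.Theory.
Import numFieldNormedType.Exports.

Local Open Scope classical_set_scope.
Local Open Scope ring_scope.

(* The library norm `|v| on 'cV[R]_k is the max norm; the Euclidean norm is
   introduced separately. *)
Definition enorm (R : realType) (k : nat) (v : 'cV[R]_k) : R :=
  Num.sqrt (\sum_i v i 0 ^+ 2).

Definition dotv (R : realType) (k : nat) (u v : 'cV[R]_k) : R :=
  (u^T *m v) 0 0.

Definition quadform (R : realType) (k : nat) (A : 'M[R]_k) (d : 'cV[R]_k) : R :=
  (d^T *m A *m d) 0 0.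

(* A - B is positive semidefinite; only used for symmetric A and B. *)
Definition loewner_ge (R : realType) (k : nat) (A B : 'M[R]_k) : Prop :=
  forall d : 'cV[R]_k, 0 <= quadform (A - B) d.

Definition gradient (R : realType) (n : nat) (f : 'cV[R]_n -> R)
    (x : 'cV[R]_n) : 'cV[R]_n :=
  \col_i 'D_(delta_mx i 0) f x.

Definition hessian (R : realType) (n : nat) (f : 'cV[R]_n -> R)
    (x : 'cV[R]_n) : 'M[R]_n :=
  \matrix_(i, j) 'D_(delta_mx j 0) (fun y => 'D_(delta_mx i 0) f y) x.

Definition C2 (R : realType) (n : nat) (f : 'cV[R]_n -> R) : Prop :=
  [/\ forall x, differentiable f x,
      forall x, differentiable (gradient f) x
    & continuous (hessian f)].

Definition decreases_to_0 (R : realType) (e : nat -> R) : Prop :=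
  [/\ forall k, 0 < e k, nonincreasing_seq e & e @ \oo --> (0 : R)].

Section NLP.
Context {R : realType} {n p m : nat}.
Variables (f : 'cV[R]_n -> R) (h : 'I_p -> 'cV[R]_n -> R)
          (g : 'I_m -> 'cV[R]_n -> R).

Definition active (x : 'cV[R]_n) : set 'I_m := [set i | g i x = 0].

Definition lagrangian (x : 'cV[R]_n) (mu : 'cV[R]_p) (omega : 'cV[R]_m) : R :=
  f x + \sum_j h j x * mu j 0 + \sum_i g i x * omega i 0.

Definition AKKT (xbar : 'cV[R]_n) (x : nat -> 'cV[R]_n) (mu : nat -> 'cV[R]_p)
    (omega : nat -> 'cV[R]_m) (eps : nat -> R) : Prop :=
  [/\ x @ \oo --> xbar,
      decreases_to_0 eps,
      forall k i, 0 <= omega k i 0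
    & forall k,
      [/\ enorm (gradient f (x k)
                 + \sum_j mu k j 0 *: gradient (h j) (x k)
                 + \sum_i omega k i 0 *: gradient (g i) (x k)) <= eps k,
          enorm (\col_j h j (x k)) <= eps k,
          enorm (\col_i Num.max 0 (g i (x k))) <= eps k
        & enorm (\col_i Num.min (omega k i 0) (- g i (x k))) <= eps k]].

Definition Stilde (y x : 'cV[R]_n) (omega : 'cV[R]_m) : set 'cV[R]_n :=
  [set d | (forall j, dotv (gradient (h j) y) d = 0) /\
           (forall i, active x i -> 0 < omega i 0 ->
                      dotv (gradient (g i) y) d = 0)].

Definition Stilde_SAKKT2 (xbar : 'cV[R]_n) : Prop :=
  exists (x : nat -> 'cV[R]_n) (mu : nat -> 'cV[R]_p)
         (omega : nat -> 'cV[R]_m) (eps : nat -> R),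
    AKKT xbar x mu omega eps /\
    forall k d, Stilde (x k) xbar (omega k) d ->
      quadform (hessian (fun y => lagrangian y (mu k) (omega k)) (x k)) d
        >= - eps k * enorm d ^+ 2.

Definition aug_lagrangian (rho : R) (x : 'cV[R]_n) (mu : 'cV[R]_p)
    (omega : 'cV[R]_m) : R :=
  f x + rho / 2 * (\sum_j (h j x + mu j 0 / rho) ^+ 2)
      + rho / 4 * (\sum_i Num.max 0 (g i x + omega i 0 / rho) ^+ 4).

Definition al_V (x : nat -> 'cV[R]_n) (omega : nat -> 'cV[R]_m)
    (rho : nat -> R) (k : nat) : 'cV[R]_m :=
  if k is 0%N then \col_i Num.max 0 (g i (x 0%N))
  else \col_i Num.max (g i (x k)) (- omega k i 0 / rho k).

(* Indices follow the algorithm: x starts at x 0, while mu, omega, rho and eps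
   start at index 1 and their values at 0 are irrelevant. *)
Record al_method (mu_min mu_max omega_max gamma tau : R)
    (x : nat -> 'cV[R]_n) (mu : nat -> 'cV[R]_p) (omega : nat -> 'cV[R]_m)
    (rho eps : nat -> R) : Prop := AlMethod {
  al_mu_bounds : mu_min < mu_max;
  al_omega_max : 0 < omega_max;
  al_gamma : 1 < gamma;
  al_rho1 : 0 < rho 1%N;
  al_tau : 0 < tau < 1;
  al_eps : decreases_to_0 (fun k => eps k.+1);
  al_mu1 : forall j, mu_min <= mu 1%N j 0 <= mu_max;
  al_omega1 : forall i, 0 <= omega 1%N i 0 <= omega_max;
  al_stationary : forall k, (1 <= k)%N ->
    enorm (gradient (fun y => aug_lagrangian (rho k) y (mu k) (omega k)) (x k))
      <= eps k;
  al_curvature : forall k, (1 <= k)%N ->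
    loewner_ge
      (hessian (fun y => aug_lagrangian (rho k) y (mu k) (omega k)) (x k))
      ((- eps k)%:M);
  al_rho_update : forall k, (1 <= k)%N ->
    rho k.+1 =
      if Num.max `|\col_j h j (x k)| `|al_V x omega rho k|
           <= tau * Num.max `|\col_j h j (x k.-1)| `|al_V x omega rho k.-1|
      then rho k else gamma * rho k;
  al_mu_update : forall k, (1 <= k)%N -> forall j,
    mu k.+1 j 0 =
      Num.max mu_min (Num.min mu_max (mu k j 0 + rho k * h j (x k)));
  al_omega_update : forall k, (1 <= k)%N -> forall i,
    omega k.+1 i 0 =
      Num.max 0 (Num.min omega_max (omega k i 0 + rho k * g i (x k)))
}.

End NLP.

(* Main.v *)
Require Import Defs.
From HB Require Import structures.
From mathcomp Require Import all_boot all_order all_algebra.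
From mathcomp Require Import all_classical all_reals all_analysis.
From mathcomp Require Import ring lra.

(** The multipliers that witness the second-order condition are the ones that
    the derivative of the augmented Lagrangian itself produces,
    [lambda_j = rho (h_j + mu_j / rho)] and
    [nu_i = rho max(0, g_i + omega_i / rho)^3]: with them the gradient of the
    augmented Lagrangian is exactly the gradient of the Lagrangian
    ([gradient_aug_lagrangian]).  Its Hessian is the Hessian of the Lagrangian
    plus the rank-one terms
      [rho sum_j grad h_j grad h_j^T
       + 3 rho sum_i max(0, g_i + omega_i / rho)^2 grad g_i grad g_i^T]
    ([quadform_hessian_aug_lagrangian]).  The quartic power makes the penalty
    of class C2, and the weight of [grad g_i] vanishes if and only if [nu_i]
    does.

    On a direction [d] of [Stilde] the terms of the equality constraints and
    those of the active constraints with [nu_i > 0] vanish; those with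
    [nu_i = 0] have weight zero.  So the curvature estimate of the algorithm
    passes to the Lagrangian with the same [eps_k], provided the inactive
    constraints contribute nothing.

    That is the one place where the penalty update matters
    ([inactive_multiplier_vanishes]): if [g_i (x k)] stays below a negative
    constant, then [g_i + omega_i / rho <= 0] for large [k], hence [nu_i = 0]
    exactly and not merely in the limit.  Either [rho] tends to infinity, and
    [omega_i / rho] tends to 0 because [omega] is bounded; or the test of
    the update eventually always succeeds, the residuals decay geometrically,
    and [max(g_i, - omega_i / rho)] tends to 0, which again forces
    [omega_i / rho] to 0.

    It also gives complementarity: [min(nu_i, - g_i (x k))] is 0 for inactive
    constraints and is at most [|g_i (x k)|] in absolute value for active ones.
    So for every [delta > 0] some iterate satisfies all the conditions with
    tolerance [delta] ([approximate_AKKT_point]).  Choosing such an iterate for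
    [delta = 1 / (l + 1)] gives the required sequence, with the harmonic
    sequence as its tolerances; it need not be a subsequence of the iterates,
    since the index may fail to increase with [l]. *)

Set Implicit Arguments.
Unset Strict Implicit.
Unset Printing Implicit Defensive.

Import Order.TTheory GRing.Theory Num.Theory.
Import numFieldNormedType.Exports.

Local Open Scope classical_set_scope.
Local Open Scope ring_scope.

(** * Scalar functions composed with a differentiable function *)

Lemma is_derive_comp_scalar (R : realType) (V : normedModType R)
    (q : R -> R) (c : V -> R) (x v : V) (dq : R) :
  differentiable c x -> is_derive (c x) 1 q dq ->
  is_derive x v (fun y => q (c y)) (dq * 'D_v c x).
Proof.
move=> dc qP.
have dfq : differentiable q (c x) by apply/derivable1_diffP; exact: ex_derive.
apply: DeriveDef; first exact/diff_derivable/(differentiable_comp dc dfq).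
rewrite (deriveE v (differentiable_comp dc dfq)) diff_comp //= deriveE //.
set w : R := 'd c x v.
have {1}-> : w = w *: (1 : R) by rewrite [RHS]mulr1.
by rewrite linearZ /= -(deriveE (1 : R) dfq) derive_val [LHS]mulrC.
Qed.

(** At the kink the difference quotient of [max(0, s)^(k+2)] is bounded by
    [|s|^(k+1)], so every power at least 2 of the positive part is
    differentiable; hence the fourth power has two derivatives. *)
Lemma is_derive_max0X (R : realType) (k : nat) (t : R) :
  is_derive t 1 (fun s => Num.max 0 s ^+ k.+2)
                (k.+2%:R * Num.max 0 t ^+ k.+1).
Proof.
have [t0|t0|->] := ltgtP t 0.
- rewrite expr0n /= mulr0.
  apply: (@near_eq_is_derive _ _ _ (cst 0)).
  near=> s; rewrite max_l ?expr0n //=; apply: ltW; near: s; exact: lt_nbhsl.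
- have powP : is_derive t 1 (fun s : R => s ^+ k.+2) (k.+2%:R * t ^+ k.+1).
    have := @is_deriveX R R id k.+2 t 1 1 (is_derive_id _ _).
    by rewrite [X in is_derive _ _ _ X]mulr1 fctE.
  apply: (near_eq_is_derive _ powP).
  near=> s; rewrite max_r //.
  by apply: ltW; near: s; exact: lt_nbhsr.
- rewrite expr0n /= mulr0.
  have H : (fun e : R => e^-1 *: (Num.max 0 (e *: (1 : R) + 0 : R) ^+ k.+2
              - Num.max 0 (0 : R) ^+ k.+2)) @ (0 : R)^' --> (0 : R).
    apply/cvgrPdist_le => e e0; near=> s.
    have s0 : s != 0 by near: s; exact: nbhs_dnbhs_neq.
    have se : `|s| <= Num.min e 1.
      near: s; apply: dnbhs0_le; by rewrite lt_min e0 ltr01.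
    move: se; rewrite le_min => /andP[se s1].
    rewrite maxxx expr0n /= subr0 sub0r normrN addr0 [s *: 1]mulr1.
    rewrite [X in `|X|](_ : _ = s^-1 * Num.max 0 s ^+ k.+2) // normrM.
    have [s_le0|s_gt0] := leP s 0; first by rewrite expr0n normr0 mulr0 ltW.
    rewrite normfV normrX exprS mulKf ?normr_eq0 //.
    by apply: le_trans se; rewrite exprS ler_piMr // exprn_ile1.
  apply: DeriveDef; first by apply/cvg_ex; exists 0.
  exact: cvg_lim H.
Unshelve. all: by end_near.
Qed.
(** * Quadratic forms and norms *)

Lemma quadformD (R : realType) (k : nat) (A B : 'M[R]_k) (d : 'cV[R]_k) :
  quadform (A + B) d = quadform A d + quadform B d.
Proof. by rewrite /quadform mulmxDr mulmxDl mxE. Qed.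

Lemma quadformZ (R : realType) (k : nat) (a : R) (A : 'M[R]_k)
    (d : 'cV[R]_k) :
  quadform (a *: A) d = a * quadform A d.
Proof. by rewrite /quadform -scalemxAr -scalemxAl mxE. Qed.

Lemma quadform_sum (R : realType) (k : nat) (I : finType) (A : I -> 'M[R]_k)
    (d : 'cV[R]_k) :
  quadform (\sum_i A i) d = \sum_i quadform (A i) d.
Proof. by rewrite /quadform mulmx_sumr mulmx_suml summxE. Qed.

Lemma quadform_rank1 (R : realType) (k : nat) (u d : 'cV[R]_k) :
  quadform (u *m u^T) d = dotv u d ^+ 2.
Proof.
rewrite /quadform /dotv !mulmxA -mulmxA mxE big_ord1 expr2; congr (_ * _).
rewrite !mxE; apply: eq_bigr => i _; rewrite !mxE; exact: mulrC.
Qed.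

Lemma sqr_enorm (R : realType) (k : nat) (v : 'cV[R]_k) :
  enorm v ^+ 2 = \sum_i v i 0 ^+ 2.
Proof. by rewrite sqr_sqrtr // sumr_ge0 // => i _; exact: sqr_ge0. Qed.

Lemma quadform_scalar (R : realType) (k : nat) (a : R) (d : 'cV[R]_k) :
  quadform a%:M d = a * enorm d ^+ 2.
Proof.
rewrite -scalemx1 quadformZ sqr_enorm /quadform mulmx1 mxE; congr (_ * _).
by apply: eq_bigr => i _; rewrite mxE expr2.
Qed.

Lemma enorm_le_sum (R : realType) (k : nat) (v : 'cV[R]_k) :
  enorm v <= \sum_i `|v i 0|.
Proof.
have S0 : 0 <= \sum_i `|v i 0| by rewrite sumr_ge0.
rewrite -(ger0_norm S0) -sqrtr_sqr ler_wsqrtr //.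
rewrite [leRHS]expr2 mulr_suml; apply: ler_sum => i _.
rewrite -real_normK ?num_real // expr2.
by rewrite ler_wpM2l // (bigD1 i) //= lerDl sumr_ge0.
Qed.

Lemma coord_le_norm (R : realType) (k : nat) (v : 'cV[R]_k) (i : 'I_k) :
  `|v i 0| <= `|v|.
Proof. by rewrite [leRHS]mx_normrE; exact: (le_bigmax _ _ (i, 0)). Qed.

(** * Gradient and Hessian of a function with separable penalties *)

Lemma differentiable_partial (R : realType) (n : nat) (c : 'cV[R]_n -> R)
    (i : 'I_n) (x : 'cV[R]_n) :
  C2 c -> differentiable (fun y => 'D_(delta_mx i 0) c y) x.
Proof.
case=> _ dgc _.
have -> : (fun y => 'D_(delta_mx i 0) c y)
        = (fun N : 'cV[R]_n => N i 0) \o gradient c.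
  by apply/funext => y; rewrite /= mxE.
exact: differentiable_comp (dgc x) (differentiable_coord _ _ _).
Qed.

Lemma is_derive_penalty (R : realType) (n q : nat)
    (c : 'I_q -> 'cV[R]_n -> R) (a da : 'I_q -> R -> R) (x v : 'cV[R]_n) :
  (forall j, C2 (c j)) -> (forall j (t : R), is_derive t 1 (a j) (da j t)) ->
  is_derive x v (fun y => \sum_j a j (c j y))
                (\sum_j da j (c j x) * 'D_v (c j) x).
Proof.
move=> c2 aP.
have -> : (fun y => \sum_j a j (c j y)) = \sum_j (fun y => a j (c j y)).
  by apply/funext => y; rewrite fct_sumE.
by apply: is_derive_sum => j; apply: is_derive_comp_scalar => //; case: (c2 j).
Qed.

Lemma is_derive_penalty2 (R : realType) (n q : nat)
    (c : 'I_q -> 'cV[R]_n -> R) (da dda : 'I_q -> R -> R) (x v : 'cV[R]_n)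
    (i : 'I_n) :
  (forall j, C2 (c j)) -> (forall j (t : R), is_derive t 1 (da j) (dda j t)) ->
  is_derive x v
    (fun y => \sum_j da j (c j y) * 'D_(delta_mx i 0) (c j) y)
    (\sum_j (da j (c j x) * 'D_v (fun y => 'D_(delta_mx i 0) (c j) y) x
             + dda j (c j x) * 'D_(delta_mx i 0) (c j) x * 'D_v (c j) x)).
Proof.
move=> c2 daP.
have -> : (fun y => \sum_j da j (c j y) * 'D_(delta_mx i 0) (c j) y)
        = \sum_j ((fun y => da j (c j y))
                  * (fun y => 'D_(delta_mx i 0) (c j) y)).
  by apply/funext => y; rewrite fct_sumE.
apply: is_derive_sum => j.
have D1 : is_derive x v (fun y => da j (c j y)) (dda j (c j x) * 'D_v (c j) x).
  by apply: is_derive_comp_scalar => //; case: (c2 j).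
have D2 := derivableP (@diff_derivable _ _ _ _ x v
                         (differentiable_partial i x (c2 j))).
have := is_deriveM D1 D2; congr is_derive.
by rewrite /GRing.scale /=; ring.
Qed.

(** The augmented Lagrangian and the Lagrangian are both of the form
    [f + sum_j a_j (h_j) + sum_i b_i (g_i)] with scalar functions [a_j] and
    [b_i], quadratic and quartic for the former, linear for the latter. *)
Section PenalizedFunction.
Context {R : realType} {n p m : nat}.
Variables (f : 'cV[R]_n -> R) (h : 'I_p -> 'cV[R]_n -> R)
          (g : 'I_m -> 'cV[R]_n -> R).
Hypotheses (f_C2 : C2 f) (h_C2 : forall j, C2 (h j))
           (g_C2 : forall i, C2 (g i)).
Variables (a da dda : 'I_p -> R -> R) (b db ddb : 'I_m -> R -> R).
Hypotheses (aP : forall j (t : R), is_derive t 1 (a j) (da j t))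
           (daP : forall j (t : R), is_derive t 1 (da j) (dda j t))
           (bP : forall i (t : R), is_derive t 1 (b i) (db i t))
           (dbP : forall i (t : R), is_derive t 1 (db i) (ddb i t)).

Let F (y : 'cV[R]_n) := f y + \sum_j a j (h j y) + \sum_i b i (g i y).

Let derive_penalized (x v : 'cV[R]_n) :
  'D_v F x = 'D_v f x + \sum_j da j (h j x) * 'D_v (h j) x
                      + \sum_i db i (g i x) * 'D_v (g i) x.
Proof.
have Df : is_derive x v f ('D_v f x).
  by apply/derivableP/diff_derivable; case: f_C2.
have Dh := is_derive_penalty x v h_C2 aP.
have Dg := is_derive_penalty x v g_C2 bP.
by rewrite -(@derive_val _ _ _ _ _ _ _ (is_deriveD (is_deriveD Df Dh) Dg)).
Qed.

Lemma gradient_penalized (x : 'cV[R]_n) :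
  gradient F x = gradient f x + \sum_j da j (h j x) *: gradient (h j) x
                              + \sum_i db i (g i x) *: gradient (g i) x.
Proof.
apply/colP => i; rewrite !mxE derive_penalized !summxE.
by congr (_ + _ + _); apply: eq_bigr => j _; rewrite !mxE.
Qed.

Lemma hessian_penalized (x : 'cV[R]_n) :
  hessian F x = hessian f x
    + \sum_j (da j (h j x) *: hessian (h j) x
              + dda j (h j x) *: (gradient (h j) x *m (gradient (h j) x)^T))
    + \sum_i (db i (g i x) *: hessian (g i) x
              + ddb i (g i x) *: (gradient (g i) x *m (gradient (g i) x)^T)).
Proof.
apply/matrixP => i j; rewrite !mxE !summxE.
under [in LHS]eq_fun do rewrite derive_penalized.
set v := delta_mx j 0.
have Df := derivableP (@diff_derivable _ _ _ _ x v
                         (differentiable_partial i x f_C2)).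
have Dh := is_derive_penalty2 x v i h_C2 daP.
have Dg := is_derive_penalty2 x v i g_C2 dbP.
rewrite (@derive_val _ _ _ _ _ _ _ (is_deriveD (is_deriveD Df Dh) Dg)).
by congr (_ + _ + _); apply: eq_bigr => l _; rewrite !mxE big_ord1 !mxE mulrA.
Qed.

Lemma quadform_hessian_penalized (x d : 'cV[R]_n) :
  quadform (hessian F x) d = quadform (hessian f x) d
    + \sum_j (da j (h j x) * quadform (hessian (h j) x) d
              + dda j (h j x) * dotv (gradient (h j) x) d ^+ 2)
    + \sum_i (db i (g i x) * quadform (hessian (g i) x) d
              + ddb i (g i x) * dotv (gradient (g i) x) d ^+ 2).
Proof.
rewrite hessian_penalized !quadformD !quadform_sum.
by congr (_ + _ + _); apply: eq_bigr => l _;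
  rewrite quadformD !quadformZ quadform_rank1.
Qed.

End PenalizedFunction.

(** * Derivatives of the augmented Lagrangian *)

Lemma is_derive_scale_shift (R : realType) (q : R -> R) (r c t dq : R) :
  is_derive (t + c) 1 q dq -> is_derive t 1 (fun s => r * q (s + c)) (r * dq).
Proof.
move=> qP; have sh : is_derive t 1 (shift c) (1 : R) by exact: is_derive_shift.
have := is_deriveZ r (@is_derive1_comp _ q (shift c) _ _ _ qP sh).
by rewrite mulr1.
Qed.

Section AugmentedLagrangian.
Context {R : realType} {n p m : nat}.
Variables (f : 'cV[R]_n -> R) (h : 'I_p -> 'cV[R]_n -> R)
          (g : 'I_m -> 'cV[R]_n -> R).
Hypotheses (f_C2 : C2 f) (h_C2 : forall j, C2 (h j))
           (g_C2 : forall i, C2 (g i)).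

(** The coefficients of [gradient (h j)] and [gradient (g i)] in the gradient
    of the augmented Lagrangian. *)
Definition shifted_eq_multiplier (rho : R) (x : 'cV[R]_n) (mu : 'cV[R]_p) :
  'cV[R]_p := \col_j (rho * (h j x + mu j 0 / rho)).

Definition shifted_ineq_multiplier (rho : R) (x : 'cV[R]_n)
    (omega : 'cV[R]_m) : 'cV[R]_m :=
  \col_i (rho * Num.max 0 (g i x + omega i 0 / rho) ^+ 3).

Let eq_penalty rho (mu : 'cV[R]_p) (j : 'I_p) (t : R) :=
  rho / 2 * (t + mu j 0 / rho) ^+ 2.
Let ineq_penalty rho (omega : 'cV[R]_m) (i : 'I_m) (t : R) :=
  rho / 4 * Num.max 0 (t + omega i 0 / rho) ^+ 4.

Let is_derive_eq_penalty rho mu j t :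
  is_derive t (1 : R) (eq_penalty rho mu j) (rho * (t + mu j 0 / rho)).
Proof.
set c := mu j 0 / rho.
have sqP : is_derive (t + c) 1 (fun s : R => s ^+ 2) (2 * (t + c)).
  have := @is_deriveX R R id 2 (t + c) 1 1 (is_derive_id _ _).
  by rewrite [X in is_derive _ _ _ X]mulr1 fctE.
have := is_derive_scale_shift (rho / 2) sqP.
by rewrite mulrA divfK ?pnatr_eq0.
Qed.

Let is_derive_eq_penalty' rho (mu : 'cV[R]_p) j (t : R) :
  is_derive t 1 (fun s => rho * (s + mu j 0 / rho)) rho.
Proof.
have idP : is_derive (t + mu j 0 / rho) 1 id (1 : R) by exact: is_derive_id.
by have := is_derive_scale_shift rho idP; rewrite mulr1.
Qed.

Let is_derive_ineq_penalty rho omega i t :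
  is_derive t (1 : R) (ineq_penalty rho omega i)
            (rho * Num.max 0 (t + omega i 0 / rho) ^+ 3).
Proof.
have := is_derive_scale_shift (rho / 4)
          (is_derive_max0X 2 (t + omega i 0 / rho)).
by rewrite mulrA divfK ?pnatr_eq0.
Qed.

Let is_derive_ineq_penalty' rho (omega : 'cV[R]_m) i (t : R) :
  is_derive t 1 (fun s => rho * Num.max 0 (s + omega i 0 / rho) ^+ 3)
            (rho * (3 * Num.max 0 (t + omega i 0 / rho) ^+ 2)).
Proof.
exact: (@is_derive_scale_shift _ (fun s => Num.max 0 s ^+ 3) _ _ _ _
          (is_derive_max0X 1 _)).
Qed.

Let aug_lagrangianE rho mu omega :
  (fun y => aug_lagrangian f h g rho y mu omega)
  = (fun y => f y + \sum_j eq_penalty rho mu j (h j y)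
                  + \sum_i ineq_penalty rho omega i (g i y)).
Proof. by apply/funext => y; rewrite /aug_lagrangian !mulr_sumr. Qed.

Lemma gradient_aug_lagrangian rho mu omega x :
  gradient (fun y => aug_lagrangian f h g rho y mu omega) x
  = gradient f x
    + \sum_j shifted_eq_multiplier rho x mu j 0 *: gradient (h j) x
    + \sum_i shifted_ineq_multiplier rho x omega i 0 *: gradient (g i) x.
Proof.
rewrite aug_lagrangianE
  (gradient_penalized f_C2 h_C2 g_C2 (is_derive_eq_penalty rho mu)
     (is_derive_ineq_penalty rho omega)).
by congr (_ + _ + _); apply: eq_bigr => l _; rewrite mxE.
Qed.

Lemma quadform_hessian_lagrangian mu omega x d :
  quadform (hessian (fun y => lagrangian f h g y mu omega) x) d
  = quadform (hessian f x) d
    + \sum_j mu j 0 * quadform (hessian (h j) x) d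
    + \sum_i omega i 0 * quadform (hessian (g i) x) d.
Proof.
have linP (a t : R) : is_derive t 1 (fun s : R => s * a) a.
  have idP : is_derive (t + 0) 1 id (1 : R) by exact: is_derive_id.
  have := is_derive_scale_shift a idP; rewrite mulr1.
  by under [X in is_derive _ _ X _ -> _]eq_fun do rewrite addr0 mulrC.
pose lin k (w : 'cV[R]_k) l (t : R) := t * w l 0.
pose slope k (w : 'cV[R]_k) l (t : R) := w l 0.
pose zero k (l : 'I_k) (t : R) := 0 : R.
have linP' k (w : 'cV[R]_k) l (t : R) :
    is_derive t 1 (lin k w l) (slope k w l t).
  exact: linP.
have slopeP k (w : 'cV[R]_k) l (t : R) :
    is_derive t 1 (slope k w l) (zero k l t).
  exact: is_derive_cst.
apply: etrans (quadform_hessian_penalized f_C2 h_C2 g_C2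
  (@linP' p mu) (@slopeP p mu) (@linP' m omega) (@slopeP m omega) x d) _.
by congr (_ + _ + _); apply: eq_bigr => l _; rewrite mul0r addr0.
Qed.

Lemma quadform_hessian_aug_lagrangian rho mu omega x d :
  quadform (hessian (fun y => aug_lagrangian f h g rho y mu omega) x) d
  = quadform (hessian (fun y => lagrangian f h g y
                (shifted_eq_multiplier rho x mu)
                (shifted_ineq_multiplier rho x omega)) x) d
    + rho * \sum_j dotv (gradient (h j) x) d ^+ 2
    + rho * \sum_i 3 * Num.max 0 (g i x + omega i 0 / rho) ^+ 2
                     * dotv (gradient (g i) x) d ^+ 2.
Proof.
rewrite aug_lagrangianE.
apply: etrans (quadform_hessian_penalized f_C2 h_C2 g_C2
  (is_derive_eq_penalty rho mu) (is_derive_eq_penalty' rho mu)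
  (is_derive_ineq_penalty rho omega)
  (is_derive_ineq_penalty' rho omega) x d) _.
rewrite [in RHS]quadform_hessian_lagrangian.
rewrite !big_split /=.
rewrite !mulr_sumr.
under [X in _ = _ + _ + X + _ + _]eq_bigr do rewrite mxE.
under [X in _ = _ + X + _ + _ + _]eq_bigr do rewrite mxE.
under [X in _ = _ + X]eq_bigr do rewrite !mulrA.
under [X in _ + (_ + X) = _]eq_bigr do rewrite !mulrA.
ring.
Qed.

(** Each rank-one term of the penalty vanishes along [d]: either [d] is
    orthogonal to the gradient, or the weight [max(0, g_i + omega_i / rho)^2]
    is zero together with the multiplier. *)
Lemma quadform_hessian_aug_lagrangian_Stilde (rho : R) (mu : 'cV[R]_p)
    (omega : 'cV[R]_m) (x xbar d : 'cV[R]_n) :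
  0 < rho ->
  (forall i, ~ active g xbar i ->
     Num.max 0 (g i x + omega i 0 / rho) = 0) ->
  Stilde h g x xbar (shifted_ineq_multiplier rho x omega) d ->
  quadform (hessian (fun y => aug_lagrangian f h g rho y mu omega) x) d
  = quadform (hessian (fun y => lagrangian f h g y
                (shifted_eq_multiplier rho x mu)
                (shifted_ineq_multiplier rho x omega)) x) d.
Proof.
move=> rho0 inactive0 [dh dg].
apply: etrans (quadform_hessian_aug_lagrangian rho mu omega x d) _.
rewrite -[RHS]addr0 -addrA; congr (_ + _).
rewrite big1 => [|j _]; last by rewrite dh expr0n.
rewrite big1 => [|i _]; first by rewrite mulr0 addr0.
have [ai|/inactive0 ->] := pselect (active g xbar i); last first.
  by rewrite expr0n mulr0 mul0r.
have [t0|t0] := leP (g i x + omega i 0 / rho) 0.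
  by rewrite expr0n mulr0 mul0r.
rewrite dg ?expr0n ?mulr0 // mxE mulr_gt0 //.
by rewrite exprn_gt0 // lt_max t0 orbT.
Qed.

End AugmentedLagrangian.

(** * Behaviour of the algorithm *)

Section Algorithm.
Context {R : realType} {n p m : nat}.
Variables (f : 'cV[R]_n -> R) (h : 'I_p -> 'cV[R]_n -> R)
          (g : 'I_m -> 'cV[R]_n -> R)
          (mu_min mu_max omega_max gamma tau : R)
          (x : nat -> 'cV[R]_n) (mu : nat -> 'cV[R]_p)
          (omega : nat -> 'cV[R]_m) (rho eps : nat -> R).
Hypothesis x_generated : al_method f h g mu_min mu_max omega_max gamma tau
                                   x mu omega rho eps.

Let residual k := Num.max `|\col_j h j (x k)| `|al_V g x omega rho k|.

Lemma omega_bounds k i : (0 < k)%N -> 0 <= omega k i 0 <= omega_max.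
Proof.
case: k => // -[_|k _]; first exact: (al_omega1 x_generated).
rewrite (al_omega_update x_generated) // le_max lexx /= ge_max ge_min lexx.
by rewrite (ltW (al_omega_max x_generated)).
Qed.

Lemma rho_gt0 k : (0 < k)%N -> 0 < rho k.
Proof.
case: k => // k _; elim: k => [|k IH]; first exact: (al_rho1 x_generated).
rewrite (al_rho_update x_generated) //; case: ifP => // _.
by rewrite mulr_gt0 // (lt_trans ltr01) // (al_gamma x_generated).
Qed.

Lemma rho_nondecreasing k l : (0 < k)%N -> (k <= l)%N -> rho k <= rho l.
Proof.
move=> k0; elim: l => [|l IH]; first by rewrite leqn0 => /eqP ->.
rewrite leq_eqVlt => /predU1P[->//|kl]; apply: (le_trans (IH kl)).
have l0 : (0 < l)%N by exact: leq_trans k0 kl.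
rewrite (al_rho_update x_generated) //; case: ifP => // _.
by rewrite ler_peMl ?(ltW (rho_gt0 l0)) // ltW // (al_gamma x_generated).
Qed.

(** Each failed test adds at least [rho 1 * (gamma - 1)] to the penalty
    parameter, so infinitely many failures make it exceed every bound. *)
Lemma rho_unbounded :
  (forall K, exists2 k, (K <= k)%N & ~~ (residual k.+1 <= tau * residual k)) ->
  forall B, \forall k \near \oo, B <= rho k.
Proof.
move=> fail B; have rho1 := al_rho1 x_generated.
have gamma1 : 0 < gamma - 1 by rewrite subr_gt0 (al_gamma x_generated).
have step k : (0 < k)%N ->
    exists2 l, (0 < l)%N & rho k + rho 1%N * (gamma - 1) <= rho l.
  move=> k0; have [l kl lfail] := fail k; exists l.+2 => //.
  have := al_rho_update x_generated (isT : (0 < l.+1)%N).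
  rewrite (negbTE lfail) => ->.
  have kl1 : rho k <= rho l.+1 by apply: rho_nondecreasing => //; exact: leqW.
  have := @rho_nondecreasing 1 l.+1 isT isT.
  nra.
have grow j : exists2 l, (0 < l)%N & rho 1%N * (gamma - 1) * j%:R <= rho l.
  elim: j => [|j [l l0 lj]]; first by exists 1%N; rewrite // mulr0 ltW.
  have [l' l'0 ll'] := step l l0; exists l' => //; apply: le_trans ll'.
  by rewrite mulrS mulrDr mulr1 addrC lerD2r.
have c0 : 0 < rho 1%N * (gamma - 1) by rewrite mulr_gt0.
have [l l0 lB] := grow (Num.bound `|B / (rho 1%N * (gamma - 1))|).
near=> k; have lk : (l <= k)%N by near: k; exact: nbhs_infty_ge.
apply: le_trans (rho_nondecreasing l0 lk); apply: le_trans lB.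
rewrite mulrC -ler_pdivrMr //; apply: le_trans (ler_norm _) _.
by apply: ltW; exact: archi_boundP (normr_ge0 _).
Unshelve. all: by end_near.
Qed.

Lemma residual_cvg0 K :
  (forall k, (K <= k)%N -> residual k.+1 <= tau * residual k) ->
  residual @ \oo --> (0 : R).
Proof.
move=> decay; have /andP[tau0 tau1] := al_tau x_generated.
have geom l : 0 <= residual (l + K) <= residual K * tau ^+ l.
  rewrite le_max normr_ge0 /=; elim: l => [|l IH]; first by rewrite mulr1.
  rewrite addSn (le_trans (decay _ (leq_addl _ _))) //.
  by rewrite exprS mulrCA ler_pM2l.
rewrite -(cvg_shiftn K); apply: (@squeeze_cvgr _ _ _ _ (cst 0)
  (geometric (residual K) tau)); first by apply: nearW => l; exact: geom.
- exact: cvg_cst.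
- by apply: cvg_geometric; rewrite ger0_norm // ltW.
Qed.

(** Where [g_i] stays below [- c], the penalty update forces
    [omega_i / rho <= c] eventually: through [al_V], which tends to 0, if the
    test fails finitely often, and otherwise because [rho] tends to infinity
    while [omega] is bounded. *)
Lemma inactive_multiplier_vanishes i c : 0 < c ->
  \forall k \near \oo, g i (x k) <= - c ->
                       g i (x k) + omega k i 0 / rho k <= 0.
Proof.
move=> c0.
have [[K decay]|fail] := pselect (exists K, forall k, (K <= k)%N ->
                                 residual k.+1 <= tau * residual k).
- have /cvgr0Pnorm_lt/(_ c c0) small := residual_cvg0 decay.
  near=> k => gk; have k0 : (0 < k)%N by near: k; exact: nbhs_infty_gt.
  have Vk : `|al_V g x omega rho k| < c.
    have : `|residual k| < c by near: k; exact: small.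
    by rewrite ger0_norm ?le_max ?normr_ge0 // gt_max => /andP[].
  have := le_lt_trans (coord_le_norm (al_V g x omega rho k) i) Vk.
  have -> : al_V g x omega rho k i 0
          = Num.max (g i (x k)) (- omega k i 0 / rho k).
    by rewrite -(prednK k0) mxE.
  rewrite ltr_norml => /andP[+ _].
  by rewrite lt_max mulNr; lra.
- have /(_ (omega_max / c)) big : forall B, \forall k \near \oo, B <= rho k.
    apply: rho_unbounded => K; apply: contrapT => none; apply: fail.
    exists K => k Kk; apply: contrapT => /negP bad; apply: none.
    by exists k.
  near=> k => gk; have k0 : (0 < k)%N by near: k; exact: nbhs_infty_gt.
  have /andP[_ ok] := omega_bounds i k0.
  suff : omega k i 0 / rho k <= c by lra.
  rewrite ler_pdivrMr ?rho_gt0 // (le_trans ok) // mulrC -ler_pdivrMr //.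
  by near: k.
Unshelve. all: by end_near.
Qed.

(** * Iterates near an accumulation point *)

Variable xstar : 'cV[R]_n.
Hypothesis xstar_acc : cluster (x @ \oo) xstar.

Lemma cluster_near (P : nat -> Prop) (Q : 'cV[R]_n -> Prop) :
  (\forall k \near \oo, P k) -> (\forall y \near xstar, Q y) ->
  exists k, P k /\ Q (x k).
Proof.
move=> nearP nearQ.
have [] := xstar_acc (A := x @` P) (B := Q) _ nearQ.
  by apply: filterS nearP => k Pk; exists k.
by move=> _ [[k Pk <-] Qk]; exists k.
Qed.

Hypothesis g_C2 : forall i, C2 (g i).
Hypothesis h_feas :
  (fun k => \sum_(j < p) h j (x k) ^+ 2) @ \oo --> (0 : R).
Hypothesis g_feas :
  (fun k => \sum_(i < m) Num.max 0 (g i (x k))) @ \oo --> (0 : R).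

Let g_continuous i : g i @ xstar --> g i xstar.
Proof. by apply: differentiable_continuous; case: (g_C2 i). Qed.

(** Feasibility makes every inactive constraint strictly negative at [xstar],
    which is what [inactive_multiplier_vanishes] asks for. *)
Lemma accumulation_point_feasible i : g i xstar <= 0.
Proof.
rewrite leNgt; apply/negP => gi0.
have half0 : 0 < g i xstar / 2 by lra.
have /cvgr0Pnorm_lt/(_ _ half0) small := g_feas.
have /cvgrPdist_lt/(_ _ half0) close := @g_continuous i.
have [k [+ +]] := cluster_near small close.
rewrite ger0_norm; last by apply: sumr_ge0 => l _; rewrite le_max lexx.
move=> /(le_lt_trans _) lt_half; rewrite ltr_norml => /andP[_ gk].
have : Num.max 0 (g i (x k)) < g i xstar / 2.
  apply: lt_half; rewrite (bigD1 i) //= lerDl.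
  by apply: sumr_ge0 => l _; rewrite le_max lexx.
by rewrite gt_max => /andP[_]; lra.
Qed.

Let nu k := shifted_ineq_multiplier g (rho k) (x k) (omega k).

(** Two kinds of conditions meet here: those that hold for all large indices,
    and those that hold in a neighbourhood of [xstar].  An accumulation point
    provides an iterate that satisfies both. *)
Lemma approximate_AKKT_point delta : 0 < delta ->
  exists k, [/\ (0 < k)%N, `|xstar - x k| < delta & eps k <= delta] /\
  [/\ enorm (\col_j h j (x k)) <= delta,
      enorm (\col_i Num.max 0 (g i (x k))) <= delta,
      enorm (\col_i Num.min (nu k i 0) (- g i (x k))) <= delta
    & forall i, ~ active g xstar i ->
        Num.max 0 (g i (x k) + omega k i 0 / rho k) = 0].
Proof.
move=> d0.
have eventually_good : \forall k \near \oo,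
    [/\ (0 < k)%N, eps k <= delta, enorm (\col_j h j (x k)) <= delta,
        enorm (\col_i Num.max 0 (g i (x k))) <= delta
      & forall i, ~ active g xstar i -> g i (x k) <= g i xstar / 2 ->
          g i (x k) + omega k i 0 / rho k <= 0].
  have [_ _] := al_eps x_generated; rewrite cvg_shiftS => eps0.
  have /cvgr0Pnorm_lt/(_ _ d0) eps_small := eps0.
  near=> k; split.
  - by near: k; exact: nbhs_infty_gt.
  - by apply: le_trans (ler_norm _) _; apply: ltW; near: k.
  - have : `|\sum_(j < p) h j (x k) ^+ 2| < delta ^+ 2.
      by near: k; move/cvgr0Pnorm_lt : h_feas => /(_ _ (exprn_gt0 2 d0)).
    move/(le_lt_trans (ler_norm _))/ltW => hk.
    rewrite -(ler_pXn2r (n := 2)) ?nnegrE ?sqrtr_ge0 ?(ltW d0) //.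
    by rewrite sqr_enorm; under eq_bigr do rewrite mxE.
  - apply: le_trans (enorm_le_sum _) _.
    have : `|\sum_(i < m) Num.max 0 (g i (x k))| < delta.
      by near: k; move/cvgr0Pnorm_lt : g_feas => /(_ _ d0).
    move/(le_lt_trans (ler_norm _))/ltW; apply: le_trans.
    by apply: ler_sum => i _; rewrite mxE ger0_norm // le_max lexx.
  - near: k; apply: filter_forall => i.
    have [ai|ai] := pselect (active g xstar i).
      by apply: nearW => k /(_ ai).
    have gi0 : g i xstar < 0.
      by rewrite lt_neqAle accumulation_point_feasible andbT; apply/eqP.
    have c0 : 0 < - (g i xstar / 2) by lra.
    by apply: filterS (inactive_multiplier_vanishes i c0) => k;
      rewrite opprK.
have close : \forall y \near xstar,
    [/\ `|xstar - y| < delta, \sum_i `|g i y - g i xstar| <= delta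
      & forall i, ~ active g xstar i -> g i y <= g i xstar / 2].
  have sum_cvg : (fun y => \sum_i `|g i y - g i xstar|) @ xstar
                 --> \sum_i `|g i xstar - g i xstar|.
    apply: (cvg_big (@add_continuous R) (nbhs_filter xstar)) => i _.
    by apply: cvg_norm; apply: cvgB => //; exact: cvg_cst.
  rewrite big1 in sum_cvg; last by move=> i _; rewrite subrr normr0.
  have /cvgr0Pnorm_lt/(_ _ d0) sum_small := sum_cvg.
  near=> y; split.
  - by near: y; exact: cvgr_dist_lt.
  - by apply: le_trans (ler_norm _) _; apply: ltW; near: y.
  - near: y; apply: filter_forall => i.
    have [ai|ai] := pselect (active g xstar i).
      by apply: nearW => y /(_ ai).
    have gi0 : g i xstar < 0.
      by rewrite lt_neqAle accumulation_point_feasible andbT; apply/eqP.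
    have c0 : 0 < - (g i xstar / 2) by lra.
    have /cvgrPdist_lt/(_ _ c0) := @g_continuous i.
    by apply: filterS => y; rewrite ltr_norml => /andP[+ _] _; lra.
have [k [[k0 epsk hk gk vanish] [xk gdist gneg]]] :=
  cluster_near eventually_good close.
have inactive0 i : ~ active g xstar i ->
    Num.max 0 (g i (x k) + omega k i 0 / rho k) = 0.
  by move=> ai; rewrite max_l // vanish // gneg.
exists k; split=> //; split=> //.
(* Componentwise, |min(nu_i, - g_i (x k))| <= |g_i (x k) - g_i xstar|. *)
apply: le_trans (enorm_le_sum _) _; apply: le_trans gdist.
apply: ler_sum => i _; rewrite !mxE.
have [ai|ai] := pselect (active g xstar i).
- rewrite (_ : g i xstar = 0) // subr0.
  have : 0 <= rho k * Num.max 0 (g i (x k) + omega k i 0 / rho k) ^+ 3.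
    by rewrite mulr_ge0 ?exprn_ge0 ?le_max ?lexx // ltW ?rho_gt0.
  set t := rho k * _ => t0.
  rewrite -(normrN (g i (x k))).
  have [tg|gt] := leP t (- g i (x k)); last by [].
  by rewrite (ger0_norm t0) (le_trans tg) // ler_norm.
- rewrite inactive0 // expr0n mulr0 min_l ?normr0 //.
  have := gneg i ai; have := accumulation_point_feasible i; lra.
Unshelve. all: by end_near.
Qed.

End Algorithm.

(** * Convergence to second-order points *)

Theorem theorem4p4 (R : realType) (n p m : nat)
    (f : 'cV[R]_n -> R) (h : 'I_p -> 'cV[R]_n -> R) (g : 'I_m -> 'cV[R]_n -> R)
    (f_C2 : C2 f) (h_C2 : forall j, C2 (h j)) (g_C2 : forall i, C2 (g i))
    (mu_min mu_max omega_max gamma tau : R)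
    (x : nat -> 'cV[R]_n) (mu : nat -> 'cV[R]_p) (omega : nat -> 'cV[R]_m)
    (rho eps : nat -> R)
    (x_generated : al_method f h g mu_min mu_max omega_max gamma tau
                             x mu omega rho eps)
    (xstar : 'cV[R]_n) (xstar_acc : cluster (x @ \oo) xstar)
    (h_feas : (fun k => \sum_(j < p) h j (x k) ^+ 2) @ \oo --> (0 : R))
    (g_feas : (fun k => \sum_(i < m) Num.max 0 (g i (x k))) @ \oo --> (0 : R)) :
  Stilde_SAKKT2 f h g xstar.
Proof.
have approx l := approximate_AKKT_point x_generated xstar_acc g_C2 h_feas g_feas
  (harmonic_gt0 l : 0 < harmonic l :> R).
have [phi phiP] := choice approx.
pose lam k := shifted_eq_multiplier h (rho k) (x k) (mu k).
pose nu k := shifted_ineq_multiplier g (rho k) (x k) (omega k).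
exists (x \o phi), (lam \o phi), (nu \o phi), harmonic.
split.
  split.
  - apply/cvgrPdist_lt => e e0.
    have /cvgr0Pnorm_lt/(_ e e0) := @cvg_harmonic R.
    apply: filterS => l he.
    have [[_ xl _] _] := phiP l.
    exact: lt_trans xl (le_lt_trans (ler_norm _) he).
  - split; [exact: harmonic_gt0| |exact: cvg_harmonic].
    by move=> k l kl; rewrite lef_pV2 ?posrE ?ltr0n // ler_nat.
  - move=> l i; have [[phi0 _ _] _] := phiP l.
    rewrite mxE mulr_ge0 ?(ltW (rho_gt0 x_generated phi0)) //.
    by rewrite exprn_ge0 // le_max lexx.
  - move=> l; have [[phi0 _ epsl] [hl gl cl _]] := phiP l.
    split => //; apply: le_trans epsl.
    have := al_stationary x_generated phi0.
    by rewrite (gradient_aug_lagrangian f_C2 h_C2 g_C2).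
move=> l d dS; have [[phi0 _ epsl] [_ _ _ inactive0]] := phiP l.
have hess_eq := quadform_hessian_aug_lagrangian_Stilde f_C2 h_C2 g_C2
  (mu (phi l)) (rho_gt0 x_generated phi0) inactive0 dS.
apply: (@le_trans _ _ (quadform (hessian (fun y => aug_lagrangian f h g
  (rho (phi l)) y (mu (phi l)) (omega (phi l))) (x (phi l))) d)); last first.
  by rewrite le_eqVlt; apply/orP; left; apply/eqP.
have := al_curvature x_generated phi0 d.
rewrite -scaleN1r quadformD quadformZ quadform_scalar mulN1r mulNr opprK.
rewrite -lerBlDr sub0r; apply: le_trans.
rewrite [leLHS]mulNr lerN2.
exact: ler_wpM2r (sqr_ge0 _) _ _ epsl.
Qed.
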